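(* For every integer $n\ge 0$, the following identities of polynomials in $q$ hold: $$M_n(q)=\sum_{\sigma\in I_n(4321)}q^{\mathrm{cr}(\sigma)+\mathrm{nes}(\sigma)}=\sum_{\sigma\in I_n(3412)}q^{\mathrm{nes}(\sigma)},$$ $$\tilde{M}_n(q)=\sum_{\sigma\in S_n(321,3\bar{1}42)}q^{\mathrm{cr}(\sigma)}.$$
   Context: $S_n$ is the set of permutations of $[n]=\{1,\dots,n\}$ ($S_0$ consists of the empty permutation), and $I_n\subseteq S_n$ is the set of involutions ($\sigma(\sigma(i))=i$ for all $i$). Pattern avoidance: an occurrence of $\tau\in S_k$ in $\sigma\in S_n$ is a subsequence $\sigma(i_1)\cdots\sigma(i_k)$, $i_1<\dots<i_k$, with $\sigma(i_x)<\sigma(i_y)$ iff $\tau(x)<\tau(y)$; $\sigma$ avoids $\tau$ if it has no occurrence of $\tau$. A permutation $\sigma$ avoids the barred pattern $3\bar{1}42$ if every occurrence of $231$ in $\sigma$ is part of an occurrence of $3142$; that is, whenever $i<j<k$ and $\sigma(k)<\sigma(i)<\sigma(j)$, there is $l$ with $i<l<j$ and $\sigma(l)<\sigma(k)$. $S_n(T)$ (resp. $I_n(T)$) is the set of elements of $S_n$ (resp. $I_n$) avoiding every pattern in the list $T$. Statistics: $\mathrm{cr}(\sigma)$ is the number of crossings of $\sigma$, i.e. pairs $(i,j)$ with $i<j<\sigma(i)<\sigma(j)$ or $\sigma(i)<\sigma(j)\le i<j$. $\mathrm{nes}(\sigma)$ is the number of nestings of $\sigma$, i.e. pairs $(i,j)$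 with $i<j<\sigma(j)<\sigma(i)$ or $\sigma(j)<\sigma(i)\le i<j$. The polynomials $M_n(q)$ and $\tilde M_n(q)$ are defined by $M_0(q)=\tilde M_0(q)=1$ and, for $n\ge1$, $$M_n(q)=M_{n-1}(q)+\sum_{k=0}^{n-2}q^{k}M_{k}(q)M_{n-2-k}(q),$$ $$\tilde{M}_n(q)=\tilde{M}_{n-1}(q)+\sum_{k=0}^{n-2}q^{k+1-(n-1)\delta_{k,n-2}}\tilde{M}_k(q)\tilde{M}_{n-2-k}(q),$$ where $\delta$ is the Kronecker symbol and empty sums are $0$. *)

(* Defs.v *)
From mathcomp Require Import all_boot all_order all_fingroup all_algebra.

Set Implicit Arguments.
Unset Strict Implicit.
Unset Printing Implicit Defensive.

Import GRing.Theory.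

(* The set [n] = {1, ..., n} is represented by 'I_n = {0, ..., n.-1}: positions
   and values are both shifted by one, which changes none of the comparisons
   below (including those between a position and a value). *)

Section Permutations.

Variable n : nat.
Implicit Types s : 'S_n.

Definition is_involution s := [forall i, s (s i) == i].

(* f lists the positions of an occurrence of t in s. *)
Definition is_occurrence k (t : 'S_k) s (f : {ffun 'I_k -> 'I_n}) :=
  [forall x : 'I_k, forall y : 'I_k, (x < y) ==> (f x < f y)] &&
  [forall x : 'I_k, forall y : 'I_k, (s (f x) < s (f y)) == (t x < t y)].

Definition avoids k (t : 'S_k) s :=
  ~~ [exists f : {ffun 'I_k -> 'I_n}, is_occurrence t s f].

(* Avoidance of the barred pattern 3-1bar-4-2: every occurrence of 231, at
   positions i < j < k, extends to an occurrence of 3142 at i < l < j < k. *)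
Definition avoids_3b142 s :=
  [forall i : 'I_n, forall j : 'I_n, forall k : 'I_n,
     [&& i < j, j < k, s k < s i & s i < s j] ==>
     [exists l : 'I_n, [&& i < l, l < j & s l < s k]]].

Definition is_crossing s (i j : 'I_n) :=
  [&& i < j, j < s i & s i < s j] || [&& s i < s j, s j <= i & i < j].

Definition is_nesting s (i j : 'I_n) :=
  [&& i < j, j < s j & s j < s i] || [&& s j < s i, s i <= i & i < j].

Definition cr s := #|[set p : 'I_n * 'I_n | is_crossing s p.1 p.2]|.
Definition nes s := #|[set p : 'I_n * 'I_n | is_nesting s p.1 p.2]|.

End Permutations.

Definition p321 : 'S_3 := perm (@rev_ord_inj 3).
Definition p4321 : 'S_4 := perm (@rev_ord_inj 4).
(* Addition in 'I_4 is modulo 4. *)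
Definition p3412 : 'S_4 := perm (@addrI 'I_4 2%R).

Definition one_line n (s : 'S_n) : seq nat := [seq (s i).+1 | i <- enum 'I_n].

Lemma one_line_p321 : one_line p321 = [:: 3; 2; 1].
Proof. by rewrite /one_line !enum_ordSl enum_ord0 /= !permE. Qed.

Lemma one_line_p4321 : one_line p4321 = [:: 4; 3; 2; 1].
Proof. by rewrite /one_line !enum_ordSl enum_ord0 /= !permE. Qed.

Lemma one_line_p3412 : one_line p3412 = [:: 3; 4; 1; 2].
Proof. by rewrite /one_line !enum_ordSl enum_ord0 /= !permE. Qed.

Definition I_4321 n := [set s : 'S_n | is_involution s && avoids p4321 s].
Definition I_3412 n := [set s : 'S_n | is_involution s && avoids p3412 s].
Definition S_321_3b142 n := [set s : 'S_n | avoids p321 s && avoids_3b142 s].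

Local Open Scope ring_scope.

Section MotzkinRecurrence.

(* e n k is the exponent of q in the k-th summand of the recurrence at n. *)
Variable e : nat -> nat -> nat.

Definition motzkin_step (n : nat) (L : seq {poly int}) : {poly int} :=
  L`_n.-1 + \sum_(0 <= k < n.-1) 'X^(e n k) * L`_k * L`_(n - 2 - k).

(* The sequence of the first n.+1 polynomials. *)
Fixpoint motzkin_seq (n : nat) : seq {poly int} :=
  if n is m.+1 then rcons (motzkin_seq m) (motzkin_step n (motzkin_seq m))
  else [:: 1].

Definition motzkin_rec (n : nat) : {poly int} := (motzkin_seq n)`_n.

Lemma size_motzkin_seq n : size (motzkin_seq n) = n.+1.
Proof. by elim: n => //= n IHn; rewrite size_rcons IHn. Qed.

Lemma nth_motzkin_seq n k : (k <= n)%N -> (motzkin_seq n)`_k = motzkin_rec k.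
Proof.
elim: n => [|n IHn]; first by rewrite leqn0 => /eqP ->.
rewrite leq_eqVlt => /predU1P[-> //|lt_kn].
by rewrite /= nth_rcons size_motzkin_seq lt_kn IHn.
Qed.

Lemma motzkin_rec0 : motzkin_rec 0 = 1. Proof. by []. Qed.

Lemma motzkin_recE n : (0 < n)%N ->
  motzkin_rec n = motzkin_rec n.-1
    + \sum_(0 <= k < n.-1)
        'X^(e n k) * motzkin_rec k * motzkin_rec (n - 2 - k).
Proof.
case: n => // n _.
rewrite {1}/motzkin_rec /= nth_rcons size_motzkin_seq ltnn eqxx.
rewrite /motzkin_step /=; congr (_ + _); apply: eq_big_nat => k /andP[_ lt_kn].
rewrite !nth_motzkin_seq //; last exact: ltnW.
by rewrite subSS -subnDA leq_subr.
Qed.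

End MotzkinRecurrence.

Definition M : nat -> {poly int} := motzkin_rec (fun n k => k).

(* The truncated subtraction is harmless: for k = n - 2 the exponent is 0. *)
Definition Mt : nat -> {poly int} :=
  motzkin_rec (fun n k => k + 1 - (n - 1) * (k == n - 2))%N.

Lemma M0 : M 0 = 1. Proof. exact: motzkin_rec0. Qed.

Lemma ME n : (0 < n)%N ->
  M n = M n.-1 + \sum_(0 <= k < n.-1) 'X^k * M k * M (n - 2 - k).
Proof. exact: motzkin_recE. Qed.

Lemma Mt0 : Mt 0 = 1. Proof. exact: motzkin_rec0. Qed.

Lemma MtE n : (0 < n)%N ->
  Mt n = Mt n.-1 + \sum_(0 <= k < n.-1)
    'X^(k + 1 - (n - 1) * (k == n - 2)%N)%N * Mt k * Mt (n - 2 - k).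
Proof. exact: motzkin_recE. Qed.

(* Main.v *)
Require Import Defs.
From mathcomp Require Import all_boot all_order all_fingroup all_algebra.
From mathcomp Require Import ring zify.

(* For every permutation s, cr s + nes s is the number of pairs (i, m) with
   i < m < s i, so it only depends on the excedance positions and the
   excedance values. Record both in a word over {0,1}^2: the i-th letter
   (o, c) tells whether i is an excedance position (o) and an excedance value
   (c). These are the ballot words, and cr + nes is an area under the path.
   An involution avoids 4321 (3412) iff no two of its arcs nest (cross), and a
   ballot word with no letter (1, 1) has exactly one nonnesting and exactly one
   noncrossing matching. A permutation avoids 321 iff it increases on its
   excedances and on its other points, and then it avoids 3-1bar-42 iff no two
   excedance positions are adjacent; each ballot word with no two adjacent o's
   comes from exactly one such permutation. The two word generating functions
   are computed, at all starting heights together, by first-passage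
   decomposition. *)

Set Implicit Arguments.
Unset Strict Implicit.
Unset Printing Implicit Defensive.

Import GRing.Theory.

Local Open Scope ring_scope.

(** * Convolution of sequences over a commutative ring *)

Section Convolution.

Variable R : comNzRingType.
Implicit Types a b c : nat -> R.

Definition conv a b n := \sum_(i < n.+1) a i * b (n - i)%N.

Definition shift a n := if n is m.+1 then a m else 0.

Lemma eq_conv a a' b b' : a =1 a' -> b =1 b' -> conv a b =1 conv a' b'.
Proof. by move=> ea eb n; apply: eq_bigr => i _; rewrite ea eb. Qed.

(** Up to index n, [conv] gives the coefficients of products of polynomials truncated at degree n,
    and these products are associative. *)
Lemma convA a b c n : conv (conv a b) c n = conv a (conv b c) n.
Proof.
pose P (d : nat -> R) := \poly_(i < n.+1) d i.
have PE d i : (i <= n)%N -> (P d)`_i = d i by move=> le_in; rewrite coef_poly ltnS le_in.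
have convE d e i : (i <= n)%N -> conv d e i = (P d * P e)`_i.
  move=> le_in; rewrite coefM; apply: eq_bigr => j _.
  have le_ji : (j <= i)%N by rewrite -ltnS.
  by rewrite !PE ?(leq_trans le_ji) // (leq_trans (leq_subr _ _)).
transitivity ((P a * P b * P c)`_n).
  rewrite coefM; apply: eq_bigr => i _.
  by rewrite -convE ?PE ?leq_subr // -ltnS.
rewrite -mulrA coefM; apply: eq_bigr => i _.
by rewrite -convE ?leq_subr // PE // -ltnS.
Qed.

Lemma conv0r a b : conv a b 0 = a 0%N * b 0%N.
Proof. by rewrite /conv big_ord1. Qed.

Lemma convSl a b n : conv a b n.+1 = a 0%N * b n.+1 + conv (a \o succn) b n.
Proof. by rewrite /conv big_ord_recl. Qed.

Lemma conv_shiftr a b n : conv a (shift b) n = shift (conv a b) n.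
Proof.
case: n => [|n]; first by rewrite conv0r mulr0.
rewrite /conv big_ord_recr /= subnn mulr0 addr0.
by apply: eq_bigr => i _; rewrite subSn // -ltnS.
Qed.

Lemma conv_shiftl a b n : conv (shift a) b n = shift (conv a b) n.
Proof.
case: n => [|n]; first by rewrite conv0r mul0r.
by rewrite convSl /= mul0r add0r.
Qed.

Lemma convDl a a' b n : conv (fun k => a k + a' k) b n = conv a b n + conv a' b n.
Proof. by rewrite -big_split; apply: eq_bigr => i _; rewrite mulrDl. Qed.

Lemma convZl x a b n : conv (fun k => x * a k) b n = x * conv a b n.
Proof. by rewrite /conv mulr_sumr; apply: eq_bigr => i _; rewrite mulrA. Qed.

Lemma convZr x a b n : conv a (fun k => x * b k) n = x * conv a b n.
Proof. by rewrite /conv mulr_sumr; apply: eq_bigr => i _; rewrite mulrCA. Qed.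

End Convolution.

(** * Ballot words and their area generating functions *)

Lemma sum_tupleS (R : nmodType) (T : finType) n (P : pred (seq T)) (F : seq T -> R) :
  \sum_(w : n.+1.-tuple T | P w) F w =
    \sum_x \sum_(w : n.-tuple T | P (x :: w)) F (x :: w).
Proof.
rewrite pair_big_dep /=.
rewrite (reindex (fun p : T * n.-tuple T => [tuple of p.1 :: p.2])) //=.
exists (fun w => (thead w, [tuple of behead w])) => [[x w] _|w _] /=.
  by congr (_, _); apply: val_inj.
by rewrite [w in RHS]tuple_eta.
Qed.

Notation letter := (bool * bool)%type.

(** A letter closes before it opens, so (1, 1) needs positive height; [area] sums the heights
    between closing and opening. *)
Fixpoint ballot (h : nat) (w : seq letter) : bool :=
  if w is (o, c) :: w' then (c <= h)%N && ballot (h - c + o) w' else h == 0%N.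

Fixpoint area (h : nat) (w : seq letter) : nat :=
  if w is (o, c) :: w' then (h - c + area (h - c + o) w')%N else 0%N.

Definition words_gf (P : pred (seq letter)) n h : {poly int} :=
  \sum_(w : n.-tuple letter | ballot h w && P w) 'X^(area h w).

Lemma words_gf_false P n h : P =1 xpred0 -> words_gf P n h = 0.
Proof. by move=> P0; apply: big_pred0 => w; rewrite P0 andbF. Qed.

Lemma words_gf0 P h : words_gf P 0 h = ((h == 0%N) && P [::])%:R.
Proof.
rewrite /words_gf big_mkcond (big_pred1 [tuple]) => [|w] /=.
  by case: ifP; rewrite ?expr0.
by rewrite (tuple0 w) /= eqxx.
Qed.

Lemma words_gfS P n h : words_gf P n.+1 h =
  \sum_(x : letter | (x.2 <= h)%N)
    'X^(h - x.2) * words_gf (fun w => P (x :: w)) n (h - x.2 + x.1).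
Proof.
rewrite /words_gf (@sum_tupleS _ _ _ (fun w => ballot h w && P w) (fun w => 'X^(area h w))).
rewrite [RHS]big_mkcond; apply: eq_bigr => -[o c] _ /=; case: ifP => _ /=;
  last by rewrite big_pred0.
by rewrite big_distrr; apply: eq_bigr => w _; rewrite exprD.
Qed.

Lemma sum_letters (F : letter -> {poly int}) (Q : pred letter) :
  \sum_(x : letter | Q x) F x =
    (if Q (false, false) then F (false, false) else 0)
  + (if Q (true, false) then F (true, false) else 0)
  + (if Q (false, true) then F (false, true) else 0)
  + (if Q (true, true) then F (true, true) else 0).
Proof.
pose G o c := if Q (o, c) then F (o, c) else 0.
rewrite big_mkcond (eq_bigr (fun x => G x.1 x.2)) => [|[] //].
rewrite -(pair_bigA _ G) /= /G.
by rewrite !big_bool /=; ring.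
Qed.

(** * Words without the letter (1, 1), counted by [M] *)

Section MotzkinWords.

Definition motzkin_word (w : seq letter) := all (fun x => ~~ (x.1 && x.2)) w.

Local Notation F := (words_gf motzkin_word).

Lemma motzkin_gf0 n : F n.+1 0 = F n 0 + F n 1.
Proof. by rewrite words_gfS sum_letters /= !addr0 expr0 !mul1r. Qed.

Lemma motzkin_gfS n h :
  F n.+1 h.+1 = 'X^(h.+1) * (F n h.+1 + F n h.+2) + 'X^h * F n h.
Proof.
rewrite words_gfS sum_letters /= subn0 subSS subn0 addn0 addn0 addn1 mulrDr.
by rewrite (@words_gf_false (fun=> false)) // mulr0 addr0.
Qed.

(** Raising a word of length k by h adds h to the weight of each letter. *)
Definition scaledM h k : {poly int} := 'X^(h * k) * M k.

(* A word from height h.+1 reaches height h for the first time after k letters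
   forming a word from 0 to 0 raised by h.+1, followed by a closer. *)
Fixpoint passageM h : nat -> {poly int} :=
  if h is h'.+1 then shift (fun n => 'X^h' * conv (scaledM h) (passageM h') n) else M.

(** The recurrence of [M] raised by h: a flat first letter weighs h; otherwise the first opener and
    its closer weigh h each, and the word between them is raised by [h.+1]. *)
Lemma scaledMS h k :
  scaledM h k.+1 = 'X^h * scaledM h k + 'X^(2 * h) * shift (conv (scaledM h.+1) (scaledM h)) k.
Proof.
rewrite /scaledM ME //= mulrDr mulrA -exprD -mulnS; congr (_ + _).
case: k => [|k]; first by rewrite big_geq // !mulr0.
rewrite big_mkord /= mulr_sumr mulr_sumr; apply: eq_bigr => i _ /=.
have -> : (k.+2 - 2 - i = k - i)%N by lia.
have expE : (h * k.+2 + i = 2 * h + h.+1 * i + h * (k - i))%N.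
  by have := ltn_ord i; nia.
transitivity ('X^(h * k.+2 + i) * (M i * M (k - i))); first by rewrite exprD; ring.
by rewrite expE !exprD; ring.
Qed.

Lemma passageM_rec n h :
  passageM h.+1 n.+1 = 'X^(h.+1) * (passageM h.+1 n + passageM h.+2 n) + 'X^h * passageM h n.
Proof.
case: n => [|n].
  rewrite /= conv0r /scaledM M0 muln0 expr0 !mul1r; ring.
(* The term split off is an immediate passage; in the others, [scaledMS] decomposes the word before
   the passage. *)
rewrite [LHS]/= convSl {1}/scaledM M0 muln0 expr0 !mul1r.
have -> : conv (scaledM h.+1 \o succn) (passageM h) n =
    'X^(h.+1) * conv (scaledM h.+1) (passageM h) n
  + 'X^(2 * h.+1) * shift (conv (scaledM h.+2) (conv (scaledM h.+1) (passageM h))) n.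
  rewrite (eq_conv (@scaledMS h.+1) (fun=> erefl _)) convDl !convZl conv_shiftl.
  by congr (_ + _ * _); case: n => //= n; rewrite convA.
have -> : passageM h.+2 n.+1 =
  'X^(h.+1) * ('X^h * shift (conv (scaledM h.+2) (conv (scaledM h.+1) (passageM h))) n).
  rewrite /=; congr (_ * _); rewrite conv_shiftr.
  by case: n => [|n] /=; rewrite ?mulr0 // convZr.
by rewrite /= (_ : 2 * h.+1 = h.+1 + h.+1)%N ?exprD; last lia; ring.
Qed.

Lemma passageM_rec0 n : M n.+1 = M n + passageM 1 n.
Proof.
rewrite ME //=; congr (_ + _).
case: n => [|n]; first by rewrite big_geq.
rewrite big_mkord /= expr0 mul1r; apply: eq_bigr => i _.
by rewrite /scaledM mul1n; congr (_ * M _); lia.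
Qed.

(** Both sides satisfy the same first-letter recurrence, which links neighbouring heights; hence the
    induction on n for all h at once. *)
Lemma motzkin_gf_passage n h : F n h = passageM h n.
Proof.
elim: n h => [|n IHn] [|h].
- by rewrite words_gf0.
- by rewrite words_gf0.
- by rewrite motzkin_gf0 !IHn; exact/esym/passageM_rec0.
- by rewrite motzkin_gfS !IHn passageM_rec.
Qed.

Lemma motzkin_gf n : F n 0 = M n.
Proof. exact: motzkin_gf_passage. Qed.

End MotzkinWords.

(** * Words without adjacent openers, counted by [Mt] *)

Section SparseWords.

(** [p] tells whether the preceding letter opens. *)
Fixpoint sparse (p : bool) (w : seq letter) : bool :=
  if w is (o, _) :: w' then ~~ (p && o) && sparse o w' else true.

Local Notation E := (words_gf (sparse false)).
Local Notation D := (words_gf (sparse true)).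

Lemma sparse_gfS0 n : E n.+1 0 = E n 0 + D n 1.
Proof. by rewrite words_gfS sum_letters /= !addr0 expr0 !mul1r. Qed.

Lemma sparse_gfSS n h :
  E n.+1 h.+1 = 'X^(h.+1) * (E n h.+1 + D n h.+2) + 'X^h * (E n h + D n h.+1).
Proof. by rewrite words_gfS sum_letters /= subn0 subSS subn0 !addn0 !addn1; ring. Qed.

Lemma sparse_gf_openS n h :
  D n.+1 h.+1 = 'X^(h.+1) * E n h.+1 + 'X^h * E n h.
Proof.
rewrite words_gfS sum_letters /= !(@words_gf_false (fun=> false)) //.
by rewrite subn0 subSS subn0 !addn0; ring.
Qed.

Definition scaledMt h k : {poly int} := 'X^(h * k) * Mt k.

(* unclosedMt h n accounts for the words of length n.+1 from height h that do not
   start with a closer. The letter of a first passage from h.+1 to h may also be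
   an opener, so together with what follows it behaves as such a word. *)
Fixpoint unclosedMt h : nat -> {poly int} :=
  if h is h'.+1 then shift (conv (scaledMt h \o succn) (unclosedMt h'))
  else Mt \o succn.

Definition passageMt h : nat -> {poly int} :=
  if h is h'.+1 then shift (conv (scaledMt h) (unclosedMt h')) else Mt.

(** The Kronecker correction cancels the exponent of the last summand, leaving [Mt k]; the other
    summands form the first passage from height 1. *)
Lemma MtSS k : Mt k.+2 = Mt k.+1 + Mt k + 'X * passageMt 1 k.
Proof.
have expE i : (i + 1 - (k.+2 - 1) * (i == k.+2 - 2) = if i == k then 0 else i.+1)%N.
  by rewrite !subSS !subn0 addn1; case: eqP => [->|_]; rewrite ?muln1 ?muln0 ?subnn ?subn0.
rewrite MtE // big_nat_recr //= expE eqxx expr0 mul1r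
  (_ : k.+2 - 2 - k = 0)%N ?Mt0 ?mulr1; last by lia.
rewrite [X in _ + X]addrC addrA; congr (_ + _).
case: k expE => [|k] expE; first by rewrite big_geq // mulr0.
rewrite big_mkord /= mulr_sumr; apply: eq_bigr => i _.
rewrite expE ltn_eqF // exprS /scaledMt mul1n -!mulrA.
by congr (_ * (_ * (_ * Mt _))); have := ltn_ord i; lia.
Qed.

(** [MtSS] raised by h. The terms stand for a flat first letter, an opener closed by the next letter
    (weights h and h), and an opener followed by a flat letter (weights h and [h + 1]). *)
Lemma scaledMtSS h k : scaledMt h k.+2 =
  'X^h * scaledMt h k.+1 + 'X^(2 * h) * scaledMt h k
  + 'X^(2 * h + 1) * shift (conv (scaledMt h.+1) (scaledMt h \o succn)) k.
Proof.
have -> : 'X^(2 * h + 1) * shift (conv (scaledMt h.+1) (scaledMt h \o succn)) k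
    = 'X^(h * k.+2) * ('X * passageMt 1 k).
  case: k => [|k]; first by rewrite /= !mulr0.
  rewrite /= !mulr_sumr; apply: eq_bigr => i _ /=; rewrite /scaledMt.
  have expE : (2 * h + 1 + h.+1 * i + h * (k - i).+1 = h * k.+3 + 1 + 1 * i)%N.
    by have := ltn_ord i; nia.
  transitivity ('X^(2 * h + 1 + h.+1 * i + h * (k - i).+1) * (Mt i * Mt (k - i).+1)).
    by rewrite !exprD; ring.
  by rewrite expE !exprD expr1; ring.
rewrite /scaledMt MtSS !mulrDr !mulrA -!exprD.
by congr ('X^_ * _ + 'X^_ * _ + _); lia.
Qed.

(** Either the first letter does not close, or it is itself the passage to h. *)
Lemma passageMtS h n : passageMt h.+1 n.+1 = unclosedMt h.+1 n + unclosedMt h n.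
Proof.
by case: n => [|n] /=; rewrite ?conv0r ?convSl /scaledMt muln0 expr0 Mt0 !mul1r ?add0r 1?addrC.
Qed.

(** The first letter is flat or opens; after an opener the next letter cannot open, so it is flat or
    closes. *)
Lemma unclosedMtS h n : unclosedMt h n.+1 =
  'X^h * passageMt h n.+1 + 'X^(2 * h + 1) * passageMt h.+1 n + 'X^(2 * h) * passageMt h n.
Proof.
case: h => [|h]; first by rewrite muln0 add0n expr0 expr1 !mul1r addrAC; exact: MtSS.
have Mt1 : Mt 1 = 1 by rewrite MtE //= big_geq // addr0 Mt0.
case: n => [|n].
  rewrite /= !conv0r /= /scaledMt muln1 muln0 expr0 Mt0 Mt1; ring.
have {1}-> : unclosedMt h.+1 n.+2 = 'X^(h.+1) * (unclosedMt h n.+1 + unclosedMt h.+1 n.+1)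
   + 'X^(2 * h.+1) * conv (scaledMt h.+1) (unclosedMt h) n
   + 'X^(2 * h.+1 + 1) * conv (scaledMt h.+2) (unclosedMt h.+1) n.
  rewrite [LHS]/= convSl.
  rewrite (eq_conv (scaledMtSS h.+1) (fun=> erefl _)) !convDl !convZl conv_shiftl.
  rewrite [conv (scaledMt h.+2) (unclosedMt h.+1) n]conv_shiftr.
  have -> : shift (conv (conv (scaledMt h.+2) (scaledMt h.+1 \o succn)) (unclosedMt h)) n
     = shift (conv (scaledMt h.+2) (conv (scaledMt h.+1 \o succn) (unclosedMt h))) n.
    by case: n => //= n; rewrite convA.
  by rewrite /= /scaledMt muln1 Mt1; ring.
by rewrite (passageMtS h n.+1) /=; ring.
Qed.

(** The second equation treats the words whose first letter does not close; over all heights the two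
    equations form a closed system. *)
Lemma sparse_gf_passage n h :
  E n h = passageMt h n /\ 'X^h * (E n h + D n h.+1) = unclosedMt h n.
Proof.
have Mt1 : Mt 1 = 1 by rewrite MtE //= big_geq // addr0 Mt0.
elim: n h => [|n IHn] h.
  rewrite !words_gf0; case: h => [|h] /=; rewrite ?expr0 ?mul1r ?Mt1 ?Mt0 ?addr0 ?mulr0 //.
have EE h' : E n.+1 h' = passageMt h' n.+1.
  case: h' => [|h'].
    by rewrite sparse_gfS0; have [_] := IHn 0%N; rewrite expr0 mul1r.
  rewrite sparse_gfSS passageMtS.
  by have [_ ->] := IHn h'; have [_ ->] := IHn h'.+1.
split=> //; rewrite EE sparse_gf_openS unclosedMtS.
have [-> _] := IHn h; have [-> _] := IHn h.+1.
by rewrite exprD !mul2n -!addnn !exprD expr1 exprS; ring.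
Qed.

Lemma sparse_gf n : E n 0 = Mt n.
Proof. exact: (sparse_gf_passage n 0).1. Qed.

End SparseWords.

(** * Prefix counts and ranks *)

Section Height.

Local Open Scope nat_scope.

(** Closers are counted through position m but openers only before it, since a letter closes
    first. *)
Lemma ballotP h (w : seq letter) : reflect
  ((forall m, m < size w -> count snd (take m.+1 w) <= h + count fst (take m w))
     /\ h + count fst w = count snd w)
  (ballot h w).
Proof.
elim: w h => [|[o c] w IHw] h /=.
  by rewrite addn0; apply: (iffP eqP) => [->|[]//]; split=> // m; rewrite ltn0.
apply: (iffP andP) => [[le_ch /IHw[le_w eq_w]]|[le_w eq_w]].
  split; last by lia.
  case=> [_|m lt_mw] /=; first by rewrite take0 /=; lia.
  by have := le_w m lt_mw; rewrite /=; lia.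
have le_ch : c <= h by have := le_w 0 isT; rewrite /= take0 /=; lia.
split=> //; apply/IHw; split; last by lia.
by move=> m lt_mw; have := le_w m.+1 lt_mw; rewrite /=; lia.
Qed.

Lemma areaE h (w : seq letter) : ballot h w ->
  area h w = \sum_(m < size w) (h + count fst (take m w) - count snd (take m.+1 w)).
Proof.
elim: w h => [|[o c] w IHw] h /=; first by rewrite big_ord0.
case/andP=> le_ch ok_w; rewrite big_ord_recl /= take0 /= IHw // !addn0; congr (_ + _).
apply: eq_bigr => m _; rewrite /bump /= add0n add1n; lia.
Qed.

Definition rank n (A : pred 'I_n) m := \sum_(j < n) (A j && (j < m)).

Lemma count_take n (T : Type) (p : pred T) (w : n.-tuple T) m :
  count p (take m w) = rank (fun j => p (tnth w j)) m.
Proof.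
elim: n w m => [|n IHn] w m.
  by rewrite tuple0 /rank big_ord0.
case/tupleP: w => x w; case: m => [|m].
  by rewrite take0 /rank big1 // => j _; rewrite andbF.
rewrite /= IHn /rank big_ord_recl tnth0 andbT; congr (_ + _).
by apply: eq_bigr => j _; rewrite tnthS.
Qed.

Section Rank.

Variable n : nat.
Implicit Types (A B : pred 'I_n) (i j : 'I_n).

Lemma rankS A i : rank A i.+1 = rank A i + A i.
Proof.
have -> : A i = \sum_j ((j == i) && A j) :> nat.
  rewrite (bigD1 i) //= eqxx big1 ?addn0 // => j /negbTE ->.
  by [].
rewrite -big_split; apply: eq_bigr => j _ /=; rewrite -val_eqE /=; lia.
Qed.

Lemma leq_rank A m p : m <= p -> rank A m <= rank A p.
Proof. by move=> le_mp; apply: leq_sum => j _; case: (A j) => //=; lia. Qed.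

Lemma ltn_rank A i m : A i -> i < m -> rank A i < rank A m.
Proof. by move=> Ai /(leq_rank A); rewrite rankS Ai addn1. Qed.

Lemma rank_inj A i j : A i -> A j -> rank A i = rank A j -> i = j.
Proof.
move=> Ai Aj eq_r; apply: val_inj; case: (ltngtP i j) => // lt_ij.
  by have := ltn_rank Ai lt_ij; rewrite eq_r ltnn.
by have := ltn_rank Aj lt_ij; rewrite eq_r ltnn.
Qed.

Lemma rankC A m : m <= n -> rank A m + rank (predC A) m = m.
Proof.
elim: m => [_|m IHm lt_mn]; first by rewrite /rank !big1 // => j _; rewrite andbF.
have := IHm (ltnW lt_mn).
rewrite (rankS A (Ordinal lt_mn)) (rankS (predC A) (Ordinal lt_mn)) /=.
by case: (A _) => /=; lia.
Qed.

Lemma rank_surj A r : r < rank A n -> exists2 i, A i & rank A i = r.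
Proof.
move=> lt_r; have exm : exists m, r < rank A m by exists n.
case: (ex_minnP exm) => -[|m].
  by rewrite /rank big1 // => j _; rewrite andbF.
move=> lt_rm min_m; have lt_mn : m < n by apply: min_m.
pose i := Ordinal lt_mn.
have le_r : rank A i <= r by rewrite leqNgt; apply/negP => /min_m; rewrite ltnn.
move: lt_rm; rewrite (rankS A i) => lt_rm.
by case: (boolP (A i)) lt_rm => Ai lt_rm; [exists i => //|]; lia.
Qed.

Lemma rank_transport A B : rank A n = rank B n ->
  exists f : 'I_n -> 'I_n, forall i, A i -> B (f i) /\ rank B (f i) = rank A i.
Proof.
move=> eqAB.
suffices /fin_all_exists : forall i, exists j, A i -> B j /\ rank B j = rank A i by [].
(* Outside [A] the value is arbitrary; i is a default. *)
move=> i; case: (boolP (A i)) => Ai; last by exists i.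
have: rank A i < rank B n by rewrite -eqAB ltn_rank.
by case/rank_surj=> j Bj rj; exists j.
Qed.

End Rank.

End Height.

(** * The word of a permutation, with its height and area *)

Section PermutationWords.

Local Open Scope nat_scope.

Variable n : nat.
Implicit Types (s : 'S_n) (i j : 'I_n).

Definition perm_word s : n.-tuple letter :=
  [tuple (i < s i, (s^-1)%g i < i) | i < n].

Lemma perm_wordP s (w : n.-tuple letter) : reflect
  (forall i, tnth w i = (i < s i, (s^-1)%g i < i)) (perm_word s == w).
Proof.
apply: (iffP eqP) => [<- i|eq_w]; first by rewrite tnth_mktuple.
by apply: eq_from_tnth => i; rewrite tnth_mktuple eq_w.
Qed.

Definition arcs_over s m := \sum_(i < n) ((i < m) && (m < s i)).

(** As many values as positions are at most m, so as many points leave this initial segment as enter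
    it. *)
Lemma card_cut s (m : nat) :
  \sum_(i < n) ((i <= m) && (m < s i)) = \sum_(i < n) ((s i <= m) && (m < i)).
Proof.
have eq_le : \sum_(i < n) (s i <= m) = \sum_(i < n) (i <= m).
  by rewrite [RHS](reindex_inj (@perm_inj _ s)).
apply: (@addnI (\sum_(i < n) ((s i <= m) && (i <= m)))).
rewrite -!big_split /=; transitivity (\sum_(i < n) (i <= m)).
  by apply: eq_bigr => i _; lia.
by rewrite -eq_le; apply: eq_bigr => i _; lia.
Qed.

Lemma exists_cut s (m : nat) i : i <= m -> m < s i -> exists2 j, s j <= m & m < j.
Proof.
move=> le_im lt_ms; apply/exists_inP; apply: contraT; rewrite negb_exists => /forallP noj.
have := card_cut s m; rewrite (bigD1 i) //= le_im lt_ms [RHS]big1 // => j _.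
by have := noj j; case: andP.
Qed.

Lemma exists_cutV s (m : nat) i : s i <= m -> m < i -> exists2 j : 'I_n, j <= m & m < s j.
Proof.
move=> le_sm lt_mi.
have [||k] := @exists_cut (s^-1)%g m (s i); rewrite ?permK //.
by exists ((s^-1)%g k) => //; rewrite permKV.
Qed.

Lemma card_pairs (P : 'I_n -> 'I_n -> bool) :
  #|[set p : 'I_n * 'I_n | P p.1 p.2]| = \sum_i \sum_j P i j.
Proof.
rewrite -sum1_card pair_bigA big_mkcond; apply: eq_bigr => p _.
by rewrite inE; case: (P _ _).
Qed.

(* The pairs counted by cr or nes with j < s j already have i < j < s i; the
   others satisfy s j <= i < j and s i <= i, and card_cut at m = i recounts
   them as pairs k < m < s k with s m <= m. *)
Lemma cr_nesE s : cr s + nes s = \sum_(m < n) arcs_over s m.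
Proof.
rewrite /cr /nes !card_pairs -big_split /=.
transitivity (\sum_(i < n) \sum_(j < n) ([&& i < j, j < s i & j < s j] : nat)
  + \sum_(i < n) \sum_(j < n) [&& s j <= i, i < j & s i <= i]).
  rewrite -big_split; apply: eq_bigr => i _; rewrite -!big_split; apply: eq_bigr => j _ /=.
  have : (i < j) ==> ((s i : nat) != s j).
    apply/implyP => lt_ij; apply: contraTneq lt_ij => /val_inj/perm_inj ->.
    by rewrite ltnn.
  rewrite /is_crossing /is_nesting; lia.
rewrite exchange_big -big_split; apply: eq_bigr => m _ /=.
have -> : \sum_(j < n) [&& s j <= m, m < j & s m <= m]
    = \sum_(j < n) [&& j <= m, m < s j & s m <= m].
  case: (s m <= m); last by rewrite !big1 // => j _; rewrite !andbF.
  transitivity (\sum_(j < n) ((s j <= m) && (m < j))).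
    by apply: eq_bigr => j _; rewrite andbT.
  by rewrite -card_cut; apply: eq_bigr => j _; rewrite andbT.
rewrite -big_split; apply: eq_bigr => j _ /=.
have : (j == m) ==> ((s j : nat) == s m) by apply/implyP => /eqP ->.
rewrite -val_eqE /=; lia.
Qed.

(** An excedance at i < m either has its value at most m, and is counted there as a closer, or
    passes strictly over m. *)
Lemma perm_word_height s (m : nat) :
  rank (fun i => (tnth (perm_word s) i).1) m =
  rank (fun i => (tnth (perm_word s) i).2) m.+1 + arcs_over s m.
Proof.
rewrite /rank [X in X + _](reindex_inj (@perm_inj _ s)) -big_split.
by apply: eq_bigr => i _ /=; rewrite !tnth_mktuple /= permK; lia.
Qed.

Lemma ballot_perm_word s : ballot 0 (perm_word s).
Proof.
apply/ballotP; split=> [m _|].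
  by rewrite !count_take perm_word_height leq_addr.
(* This is the height identity at m = n: the prefix of length [n.+1] is the whole word, and no arc
   passes over n. *)
rewrite -{1}[tval _]take_size
  -[X in _ = count _ X](@take_oversize _ n.+1) ?size_tuple // !count_take.
by rewrite perm_word_height /arcs_over big1 ?addn0 // => i _; have := ltn_ord (s i); lia.
Qed.

Lemma area_perm_word s : area 0 (perm_word s) = cr s + nes s.
Proof.
rewrite areaE ?ballot_perm_word // size_tuple cr_nesE; apply: eq_bigr => m _.
by rewrite !count_take perm_word_height add0n addKn.
Qed.

Lemma ballot_rank (w : n.-tuple letter) : ballot 0 w ->
  (forall i, rank (fun i => (tnth w i).2) i.+1 <= rank (fun i => (tnth w i).1) i) /\
  rank (fun i => (tnth w i).1) n = rank (fun i => (tnth w i).2) n.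
Proof.
case/ballotP=> le_w eq_w; split=> [i|]; rewrite -!count_take.
  by apply: le_w; rewrite size_tuple.
by rewrite -{1 3}(size_tuple w) !take_size.
Qed.

End PermutationWords.

(** The hypotheses make [perm_word] a bijection from [C] onto the ballot words in [P], and it
    carries [cr + nes] to the area. *)
Lemma perm_class_gf n (C : {set 'S_n}) (P : pred (seq letter)) :
    {in C &, injective (@perm_word n)} ->
    {in C, forall s, P (perm_word s)} ->
    (forall w : n.-tuple letter, ballot 0 w -> P w -> exists2 s, s \in C & perm_word s = w) ->
  \sum_(s in C) 'X^(cr s + nes s) = words_gf P n 0.
Proof.
move=> injC PC surjC; rewrite /words_gf.
transitivity (\sum_(w in [set perm_word s | s in C]) 'X^(area 0 w) : {poly int}).
  by rewrite big_imset //=; apply: eq_bigr => s _; rewrite area_perm_word.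
apply: eq_bigl => w; apply/imsetP/andP => [[s sC ->]|[bw Pw]].
  by rewrite ballot_perm_word PC.
by have [s] := surjC w bw Pw; exists s.
Qed.

(** * Uniqueness and existence of permutations with a given word *)

Section Classes.

Local Open Scope nat_scope.

Variable n : nat.
Implicit Types (s t : 'S_n) (i j k : 'I_n) (w : n.-tuple letter).

Lemma perm_word_inj s t : perm_word s = perm_word t ->
  (forall i, (i < s i) = (i < t i)) /\
  (forall i, ((s^-1)%g i < i) = ((t^-1)%g i < i)).
Proof.
by move=> eq_st; split=> i; have := congr1 (fun w => tnth w i) eq_st;
  rewrite !tnth_mktuple => -[].
Qed.

Lemma perm_word_exc s t i j : perm_word s = perm_word t -> s i = t j ->
  (i < s i) = (j < t j).
Proof.
move=> /perm_word_inj[_ eqV] eq_ij.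
by have := eqV (s i); rewrite {3}eq_ij !permK eq_ij.
Qed.

Definition exc_monotone s :=
  forall i j, i < j -> (i < s i) = (j < s j) -> s i < s j.

(** At the first i where u and v differ, say with [u i < v i], v takes the value [u i] at some j of
    the same class; j < i contradicts the agreement before i, and j > i the monotonicity of v. *)
Lemma exc_monotone_inj s t : exc_monotone s -> exc_monotone t ->
  perm_word s = perm_word t -> s = t.
Proof.
have le_uv u v i : exc_monotone v -> perm_word u = perm_word v ->
    (forall j, j < i -> u j = v j) -> v i <= u i.
  move=> mv eq_uv IHi; rewrite leqNgt; apply/negP => lt_uv.
  have [j vj] : exists j, v j = u i by exists ((v^-1)%g (u i)); rewrite permKV.
  have := mv i j; rewrite -(perm_word_exc eq_uv (esym vj)) (perm_word_inj eq_uv).1 vj.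
  case: (ltngtP i j) => [_ /(_ isT erefl)|lt_ji _|/val_inj eq_ij _]; first by lia.
    by move: lt_ji (lt_ji) => /IHi; rewrite vj => /perm_inj ->; rewrite ltnn.
  by move: lt_uv; rewrite eq_ij vj -eq_ij ltnn.
move=> ms mt eq_st; apply/permP => i.
have [m] := ubnP (nat_of_ord i); elim: m i => // m IHm i lt_im.
have IHi j : j < i -> s j = t j by move=> lt_ji; apply: IHm; lia.
apply/val_inj/anti_leq/andP; split; last exact: le_uv.
by apply: le_uv => // j /IHi.
Qed.

Lemma involutionP s : reflect (forall i, s (s i) = i) (is_involution s).
Proof. exact: 'forall_eqP. Qed.

Lemma involution_inv s i : is_involution s -> (s^-1)%g i = s i.
Proof. by move=> /involutionP ss; apply: (@perm_inj _ s); rewrite permKV ss. Qed.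

Lemma eq_involution s t : is_involution s -> is_involution t ->
    perm_word s = perm_word t -> (forall i, i < s i -> t i = s i) -> s = t.
Proof.
move=> Is It /perm_word_inj[eq_exc eq_inv] eq_st; apply/permP => i.
have := eq_exc i; have := eq_inv i; rewrite !involution_inv //.
case: (ltngtP i (s i)) => [/eq_st-> // | lt_si _ _ | /val_inj eq_i].
  have := eq_st (s i); rewrite (involutionP _ Is) => /(_ lt_si) eq_t.
  by rewrite -{2}eq_t (involutionP _ It).
by rewrite -eq_i => le_ti le_it; apply: val_inj => /=; lia.
Qed.

Definition nonnesting s := forall i j, ~~ [&& i < j, j < s j & s j < s i].
Definition noncrossing s := forall i j, ~~ [&& i < j, j < s i & s i < s j].

(** As for [exc_monotone_inj], restricted to openers: with j > i, the arc of v at j would nest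
    inside the arc at i. *)
Lemma nonnesting_inj s t : is_involution s -> is_involution t ->
  nonnesting s -> nonnesting t -> perm_word s = perm_word t -> s = t.
Proof.
have le_uv u v i : nonnesting v -> perm_word u = perm_word v ->
    (forall j, j < i -> j < u j -> u j = v j) -> i < u i -> v i <= u i.
  move=> nv eq_uv IHi lt_iu; rewrite leqNgt; apply/negP => lt_uv.
  have [j vj] : exists j, v j = u i by exists ((v^-1)%g (u i)); rewrite permKV.
  have lt_jv : j < u i by rewrite -{1}vj -(perm_word_exc eq_uv (esym vj)).
  have := nv i j; rewrite vj lt_jv lt_uv andbT.
  case: (ltngtP i j) => // [lt_ji|/val_inj eq_ij] _.
    have := IHi j lt_ji; rewrite (perm_word_inj eq_uv).1 vj => /(_ lt_jv)/perm_inj eq_ji.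
    by rewrite eq_ji ltnn in lt_ji.
  by move: lt_uv; rewrite eq_ij vj -eq_ij ltnn.
move=> Is It ns nt eq_st; apply: eq_involution => // i.
have [m] := ubnP (nat_of_ord i); elim: m i => // m IHm i lt_im lt_is.
have IHi j : j < i -> j < s j -> t j = s j by move=> lt_ji; apply: IHm; lia.
apply/val_inj/anti_leq/andP; split.
  by apply: le_uv => // j lt_ji lt_js; rewrite IHi.
apply: le_uv => // [j lt_ji lt_jt|]; last by rewrite -(perm_word_inj eq_st).1.
by apply: IHi; rewrite // (perm_word_inj eq_st).1.
Qed.

(* Induction on the length of the arc (a, s a): if t pairs a or s a differently,
   then s has a shorter arc inside (a, s a) on which s and t disagree. *)
Lemma noncrossing_inj s t : is_involution s -> is_involution t ->
  noncrossing s -> noncrossing t -> perm_word s = perm_word t -> s = t.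
Proof.
move=> Is It ns nt eq_st; apply: eq_involution => // a.
have ss := involutionP _ Is; have tt := involutionP _ It.
have [exc_st inv_st] := perm_word_inj eq_st.
have cls_st i : (s i < i) = (t i < i) by have := inv_st i; rewrite !involution_inv.
have [m] := ubnP (s a - a); elim: m a => // m IHm a lt_m lt_as.
have lt_at : a < t a by rewrite -exc_st.
have lt_tb : t (s a) < s a by rewrite -cls_st ss.
apply: val_inj; case: (ltngtP (t a) (s a)) => // [lt_ts|lt_st].
  have lt_c : s (t a) < t a by rewrite cls_st tt.
  have := ns (s (t a)) a; rewrite ss lt_at lt_ts !andbT.
  case: (ltngtP a (s (t a))) => // [lt_ac _|/val_inj eq_a _]; last first.
    by move: lt_ts; rewrite eq_a ss -eq_a ltnn.
  have : t (s (t a)) = s (s (t a)) by apply: IHm; rewrite ?ss //; lia.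
  by rewrite ss => /perm_inj eq_a; rewrite eq_a ltnn in lt_ac.
(* As t has no crossing, it pairs [s a] with an opener after [a]; the arc of s at that opener is the
   shorter one sought. *)
have := nt (t (s a)) a; rewrite tt lt_as lt_st !andbT.
case: (ltngtP a (t (s a))) => // [lt_aa _|/val_inj eq_a _]; last first.
  by move: lt_st; rewrite {2}eq_a tt ltnn.
set a' := t (s a) in lt_aa lt_tb; have ta' : t a' = s a by rewrite /a' tt.
have lt_a's : a' < s a' by rewrite exc_st ta'.
have := ns a a'; rewrite lt_aa lt_tb /= -leqNgt leq_eqVlt.
case/orP => [/eqP/val_inj/perm_inj eq_a|lt_ss]; first by rewrite eq_a ltnn in lt_aa.
have : t a' = s a' by apply: IHm => //; lia.
by rewrite ta' => /perm_inj eq_a; rewrite -eq_a ltnn in lt_aa.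
Qed.


(** Send the r-th opener to the r-th closer, and the r-th other position to the r-th other value. *)
Lemma exists_exc_monotone w : ballot 0 w ->
  exists2 s, exc_monotone s & perm_word s = w.
Proof.
move=> /ballot_rank[le_BA eq_AB].
set A := (fun i => (tnth w i).1) in le_BA eq_AB.
set B := (fun i => (tnth w i).2) in le_BA eq_AB.
have [f fP] := rank_transport eq_AB.
have eq_ABC : rank (predC A) n = rank (predC B) n.
  by apply/(@addnI (rank A n)); rewrite rankC // eq_AB rankC.
have [g gP] := rank_transport eq_ABC.
(* Otherwise the closers through [f i] would outnumber the openers before it. *)
have lt_f i : A i -> i < f i.
  move=> Ai; have [Bf rk_f] := fP i Ai; rewrite ltnNge; apply/negP => le_fi.
  by have := le_BA (f i); have := leq_rank A le_fi; rewrite (rankS B) Bf; lia.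
(* Otherwise the non-closers through i would be at most the non-openers before i, so the closers
   through i would outnumber the openers before i. *)
have le_g i : ~~ A i -> g i <= i.
  move=> Ai; have [Bg rk_g] := gP i Ai; rewrite leqNgt; apply/negP => lt_ig.
  have := leq_rank (predC B) lt_ig; have := rankC A (ltnW (ltn_ord i)).
  by have := rankC B (ltn_ord i); have := le_BA i; lia.
pose h i := if A i then f i else g i.
have hB i : B (h i) = A i.
  by rewrite /h; case: (boolP (A i)) => Ai; [have [] := fP i Ai | have [/negbTE] := gP i Ai].
have h_inj : injective h.
  move=> i j eq_h; have := hB j; rewrite -eq_h hB; move: eq_h; rewrite /h.
  case: (boolP (A i)) => Ai eq_h Aj; rewrite -Aj in eq_h.
    by apply: (@rank_inj _ A) => //; rewrite -(fP i Ai).2 -(fP j _).2 ?eq_h.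
  by apply: (@rank_inj _ (predC A)); rewrite /= -?Aj // -(gP i Ai).2 -(gP j _).2 ?eq_h /= -?Aj.
exists (perm h_inj); last first.
  apply/eqP/perm_wordP => i; rewrite [LHS]surjective_pairing; congr (_, _).
    rewrite permE /h -/(A i); case: (boolP (A i)) => [/lt_f-> //|/le_g].
    by rewrite leqNgt => /negbTE ->.
  set k := ((perm h_inj)^-1)%g i; have <- : h k = i by rewrite -(permE h_inj) permKV.
  rewrite -/(B (h k)) hB /h; case: (boolP (A k)) => [/lt_f-> //|/le_g].
  by rewrite leqNgt => /negbTE ->.
move=> i j lt_ij; rewrite !permE /h.
have excE k : (k < h k) = A k.
  by rewrite /h; case: (boolP (A k)) => [/lt_f-> //|/le_g]; rewrite leqNgt => /negbTE.
rewrite -/(h i) -/(h j) !excE => eqA; rewrite /h -eqA; case: (boolP (A i)) => Ai.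
  rewrite ltnNge; apply/negP => /(leq_rank B); rewrite (fP i Ai).2 (fP j _).2 -?eqA //.
  by rewrite leqNgt ltn_rank.
rewrite ltnNge; apply/negP => /(leq_rank (predC B)).
rewrite (gP i Ai).2 (gP j _).2 /= -?eqA //.
by rewrite leqNgt (@ltn_rank _ (predC A)).
Qed.

Lemma motzkin_wordP w :
  reflect (forall i, ~~ ((tnth w i).1 && (tnth w i).2)) (motzkin_word w).
Proof. exact: all_tnthP. Qed.

(** Pair the r-th opener with the r-th closer and fix the rest; an order-preserving pairing has no
    nesting. *)
Lemma exists_nonnesting w : ballot 0 w -> motzkin_word w ->
  exists s, [/\ is_involution s, nonnesting s & perm_word s = w].
Proof.
move=> /ballot_rank[le_BA eq_AB] /motzkin_wordP disjAB.
set A := (fun i => (tnth w i).1) in le_BA eq_AB.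
set B := (fun i => (tnth w i).2) in le_BA eq_AB.
have [f fP] := rank_transport eq_AB; have [g gP] := rank_transport (esym eq_AB).
have lt_f i : A i -> i < f i.
  move=> Ai; have [Bf rk_f] := fP i Ai; rewrite ltnNge; apply/negP => le_fi.
  by have := le_BA (f i); have := leq_rank A le_fi; rewrite (rankS B) Bf; lia.
have AnB i : A i -> B i = false.
  by have := disjAB i; rewrite -/(A i) -/(B i); do 2!case: (_ i).
have BnA i : B i -> A i = false.
  by have := disjAB i; rewrite -/(A i) -/(B i); do 2!case: (_ i).
have fK i : A i -> g (f i) = i.
  move=> Ai; have [Bf rf] := fP i Ai; have [Ag rg] := gP _ Bf.
  by apply: (@rank_inj _ A) => //; rewrite rg rf.
have gK i : B i -> f (g i) = i.
  move=> Bi; have [Ag rg] := gP i Bi; have [Bf rf] := fP _ Ag.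
  by apply: (@rank_inj _ B) => //; rewrite rf rg.
have lt_g i : B i -> g i < i.
  by move=> Bi; rewrite -{2}(gK i Bi) lt_f //; have [] := gP i Bi.
pose h i := if A i then f i else if B i then g i else i.
have hK : involutive h.
  move=> i; rewrite /h; case: (boolP (A i)) => Ai.
    by have [Bf _] := fP i Ai; rewrite BnA // Bf fK.
  case: (boolP (B i)) => Bi; last by rewrite (negbTE Ai) (negbTE Bi).
  by have [Ag _] := gP i Bi; rewrite Ag gK.
have excE i : (i < h i) = A i.
  rewrite /h; case: (boolP (A i)) => [/lt_f //|_]; case: (boolP (B i)) => [/lt_g|_]; lia.
have excVE i : (h i < i) = B i.
  rewrite /h; case: (boolP (A i)) => [Ai|_]; first by rewrite AnB //; have := lt_f i Ai; lia.
  by case: (boolP (B i)) => [/lt_g|_]; lia.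
pose s := perm (can_inj hK).
have Is : is_involution s by apply/involutionP => i; rewrite !permE hK.
exists s; split=> //.
  move=> i j; apply/negP; rewrite !permE => /and3P[lt_ij lt_j lt_h].
  have Aj : A j by rewrite -excE.
  have Ai : A i by rewrite -excE; lia.
  move: lt_h; rewrite /h Ai Aj => /ltnW/(leq_rank B).
  by rewrite (fP i Ai).2 (fP j Aj).2 leqNgt ltn_rank.
apply/eqP/perm_wordP => i.
by rewrite involution_inv // !permE excE excVE -surjective_pairing.
Qed.

(** The rearrangement inequality for the four ends of two arcs. *)
Lemma rearrange_lt a b c d r : a < b -> c < d ->
  a * d + (b * c + (c * b + (d * a + r))) < a * c + (b * d + (c * a + (d * b + r))).
Proof. by move=> /subnKC <- /subnKC <-; nia. Qed.

(* Conjugation by the two closers turns the crossing arcs (i, s i), (j, s j) into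
   the nested arcs (i, s j), (j, s i). *)
Lemma uncross s i j : is_involution s -> i < j -> j < s i -> s i < s j ->
  let t := (tperm (s i) (s j) * s * tperm (s i) (s j))%g in
  [/\ is_involution t, perm_word t = perm_word s &
      \sum_(k < n) k * t k < \sum_(k < n) k * s k].
Proof.
move=> Is lt_ij lt_jsi lt_ss t; have ss := involutionP _ Is.
have neq (k l : 'I_n) : k < l -> k != l by apply: contraTneq => ->; rewrite ltnn.
have ne_ij := neq i j lt_ij; have ne_jsi := neq j _ lt_jsi; have ne_ss := neq _ _ lt_ss.
have ne_isi : i != s i by apply: neq; lia.
have ne_isj : i != s j by apply: neq; lia.
have ne_jsj : j != s j by apply: neq; lia.
have ti : t i = s j by rewrite !permM (tpermD (z := i)) 1?eq_sym // tpermL.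
have tj : t j = s i by rewrite !permM (tpermD (z := j)) 1?eq_sym // tpermR.
have tsi : t (s i) = j by rewrite !permM tpermL ss tpermD // eq_sym.
have tsj : t (s j) = i by rewrite !permM tpermR ss tpermD // eq_sym.
have tE k : k != i -> k != j -> k != s i -> k != s j -> t k = s k.
  by move=> *; rewrite !permM (tpermD (z := k)) 1?eq_sym // tpermD // (inj_eq perm_inj) eq_sym.
have It : is_involution t by apply/involutionP => k; rewrite !permM tpermK ss tpermK.
split=> //.
  apply/esym/eqP/perm_wordP => k; rewrite tnth_mktuple !involution_inv //.
  have [->|ki] := eqVneq k i;
    first by rewrite ti; congr (_, _); clear - lt_ij lt_jsi lt_ss; lia.
  have [->|kj] := eqVneq k j;
    first by rewrite tj; congr (_, _); clear - lt_ij lt_jsi lt_ss; lia.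
  have [->|ksi] := eqVneq k (s i);
    first by rewrite tsi ss; congr (_, _); clear - lt_ij lt_jsi lt_ss; lia.
  have [->|ksj] := eqVneq k (s j);
    first by rewrite tsj ss; congr (_, _); clear - lt_ij lt_jsi lt_ss; lia.
  by rewrite tE.
have sum4 u : \sum_(k < n) k * u k = i * u i + (j * u j + (s i * u (s i) + (s j * u (s j)
    + \sum_(k < n | [&& k != i, k != j, k != s i & k != s j]) k * u k))).
  rewrite (bigD1 i) // (bigD1 j) 1?eq_sym //= (bigD1 (s i)) /=;
    last by rewrite ![s i == _]eq_sym ne_isi.
  rewrite (bigD1 (s j)) /=; last by rewrite ![s j == _]eq_sym ne_isj ne_jsj.
  by do !congr (_ + _); apply: eq_bigl => k; rewrite -!andbA.
rewrite !sum4 ti tj tsi tsj !ss.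
rewrite (eq_bigr (fun k => k * s k)) => [|k /and4P[ki kj ksi ksj]]; last by rewrite tE.
exact: rearrange_lt.
Qed.

(** Among the involutions with word w, one that minimizes the sum of [k * s k] has no crossing,
    since [uncross] would lower the sum. *)
Lemma exists_noncrossing w : ballot 0 w -> motzkin_word w ->
  exists s, [/\ is_involution s, noncrossing s & perm_word s = w].
Proof.
move=> bw Mw; have [s0 [Is0 _ w0]] := exists_nonnesting bw Mw.
pose P s := is_involution s && (perm_word s == w).
have P0 : P s0 by rewrite /P Is0 w0 /=.
case: (arg_minnP (P := P) (fun s => \sum_(k < n) k * s k) P0) => s /andP[Is /eqP ws] min_s.
exists s; split=> // i j; apply/negP => /and3P[lt_ij lt_jsi lt_ss].
have [It wt] := uncross Is lt_ij lt_jsi lt_ss.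
by rewrite ltnNge min_s // /P It wt ws /=.
Qed.

(** * Pattern avoidance in terms of arcs and excedances *)

Lemma avoidsPn m (p : 'S_m) s : reflect
  (exists f : 'I_m -> 'I_n, (forall x y : 'I_m, x < y -> f x < f y) /\
     (forall x y, (s (f x) < s (f y)) = (p x < p y)))
  (~~ avoids p s).
Proof.
rewrite negbK; apply: (iffP existsP) => [[f /andP[/forallP inc /forallP ord]]|[f [inc ord]]].
  exists f; split=> x y; first by have /forallP/(_ y)/implyP := inc x.
  by have /forallP/(_ y)/eqP := ord x.
exists (finfun f); apply/andP; split; apply/forallP => x; apply/forallP => y; rewrite !ffunE.
  exact/implyP/inc.
exact/eqP/ord.
Qed.

Lemma avoids_p321P s : reflect
  (forall i j k, ~~ [&& i < j, j < k, s k < s j & s j < s i]) (avoids p321 s).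
Proof.
apply: (iffP idP) => [av i j k|av].
  apply/negP => /and4P[ij jk kj ji]; suff /negP[] : ~~ avoids p321 s by [].
  apply/avoidsPn.
  exists (tnth [tuple i; j; k]); split; do 2!case=> [[|[|[|//]]] ?];
    rewrite ?permE /tnth /=; lia.
apply: contraT => /avoidsPn[f [inc ord]].
have := av (f 0%R) (f (inord 1)) (f (inord 2)).
by rewrite !inc ?inordK // !ord !permE /= !inordK.
Qed.

(** In an occurrence i < j < k < l, the arcs from i and j nest if j is an excedance; otherwise
    [s k < s j <= j < k], and the arcs ending at k and l nest. *)
Lemma avoids_p4321P s : is_involution s -> reflect (nonnesting s) (avoids p4321 s).
Proof.
move=> Is; have ss := involutionP _ Is; apply: (iffP idP) => [av i j|nn].
  apply/negP => /and3P[ij jj ji]; suff /negP[] : ~~ avoids p4321 s by [].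
  apply/avoidsPn.
  exists (tnth [tuple i; j; s j; s i]); split; do 2!case=> [[|[|[|[|//]]]] ?];
    rewrite ?permE /tnth /= ?ss; lia.
apply: contraT => /avoidsPn[f [inc ord]].
pose i := f 0%R; pose j := f (inord 1); pose k := f (inord 2); pose l := f (inord 3).
have [ij jk kl] : [/\ i < j, j < k & k < l] by split; apply: inc; rewrite !inordK.
have [ji kj lk] : [/\ s j < s i, s k < s j & s l < s k].
  by rewrite !ord !permE /= !inordK.
case: (ltnP j (s j)) => [lt_j|le_j].
  by have := nn i j; rewrite ij lt_j ji.
by have := nn (s l) (s k); rewrite !ss lk kl andbT /=; lia.
Qed.

Lemma p3412E (x : 'I_4) : p3412 x = (2 + x) %% 4 :> nat.
Proof. by rewrite permE. Qed.

(** In an occurrence i < j < k < l, the arcs from i and j cross if [j < s i]; otherwise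
    [s l < s i <= j < k], and the arcs ending at k and l cross. *)
Lemma avoids_p3412P s : is_involution s -> reflect (noncrossing s) (avoids p3412 s).
Proof.
move=> Is; have ss := involutionP _ Is; apply: (iffP idP) => [av i j|nc].
  apply/negP => /and3P[ij jj ji]; suff /negP[] : ~~ avoids p3412 s by [].
  apply/avoidsPn.
  exists (tnth [tuple i; j; s i; s j]); split; do 2!case=> [[|[|[|[|//]]]] ?];
    rewrite ?p3412E /tnth /= ?ss; lia.
apply: contraT => /avoidsPn[f [inc ord]].
pose i := f 0%R; pose j := f (inord 1); pose k := f (inord 2); pose l := f (inord 3).
have [ij jk kl] : [/\ i < j, j < k & k < l] by split; apply: inc; rewrite !inordK.
have [kl' li ij'] : [/\ s k < s l, s l < s i & s i < s j].
  by rewrite !ord !p3412E /= !inordK.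
case: (ltnP j (s i)) => [lt_j|le_j].
  by have := nc i j; rewrite ij lt_j ij'.
by have := nc (s k) (s l); rewrite !ss kl kl' andbT /=; lia.
Qed.

(** A crossing of the second kind, read from the openers [s i] and [s j], is one of the first kind
    unless [s j = i], which forces [s i = j] and contradicts [s i < s j]. *)
Lemma noncrossing_cr s : is_involution s -> noncrossing s -> cr s = 0.
Proof.
move=> Is nc; have ss := involutionP _ Is.
apply/eqP; rewrite cards_eq0 -subset0; apply/subsetP => -[i j]; rewrite !inE /is_crossing /=.
case/orP; first by rewrite (negbTE (nc i j)).
case/and3P=> lt_ss le_si lt_ij; have := nc (s i) (s j).
rewrite !ss lt_ss lt_ij andbT /= -leqNgt => le_is.
have /val_inj eq_i : i = s j :> nat by lia.
by move: lt_ss; rewrite eq_i ss -eq_i; lia.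
Qed.

Lemma exc_monotone_nes s : exc_monotone s -> nes s = 0.
Proof.
move=> ms; apply/eqP; rewrite cards_eq0 -subset0; apply/subsetP => -[i j].
rewrite !inE /is_nesting /=; case/orP => /and3P[h1 h2 h3].
  by have := ms i j h1; lia.
by have := ms i j h3; lia.
Qed.

(** Of three positions two share a class. Conversely, a cut argument extends an inversion within a
    class to a 321: on the right for excedances, on the left for the others. *)
Lemma avoids_p321_excP s : reflect (exc_monotone s) (avoids p321 s).
Proof.
apply: (iffP (avoids_p321P s)) => [av i j lt_ij eq_exc | ms i j k]; last first.
  apply/negP => /and4P[ij jk kj ji].
  have := ms _ _ ij; have := ms _ _ jk; have := ms i k; lia.
rewrite ltnNge leq_eqVlt; apply/negP => /predU1P[/val_inj/perm_inj eq_ij|lt_ji].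
  by rewrite eq_ij ltnn in lt_ij.
case: (ltnP j (s j)) eq_exc => [lt_j _|le_j le_i].
  have [k le_k lt_k] := exists_cut (leqnn j) lt_j.
  by have := av i j k; rewrite lt_ij lt_k lt_ji andbT /=; lia.
have le_ji : s j <= i by lia.
have [k le_k lt_k] := exists_cutV le_ji lt_ij.
have ne_k : (k : nat) != i by apply: contraTneq lt_k => /val_inj ->; lia.
by have := av k i j; rewrite lt_ij lt_ji /=; lia.
Qed.

Definition sparse_exc s := forall i j, j = i.+1 :> nat -> ~~ ((i < s i) && (j < s j)).

(** Two adjacent excedances start a 231 with no room between them. Conversely, in a 231 at i, j, k
    the excedances are i and j but not k, so [i.+1] is a non-excedance before j and its value is
    below [s k]. *)
Lemma avoids_3b142P s : exc_monotone s -> reflect (sparse_exc s) (avoids_3b142 s).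
Proof.
move=> ms; apply: (iffP idP) => [av i j eq_j|sp].
  apply/negP => /andP[exc_i exc_j].
  have [k le_k lt_k] := exists_cut (leqnn j) exc_j.
  have lt_ij : i < j by rewrite eq_j.
  have ne_k : (s k : nat) != s i.
    by apply: contraTneq lt_k => /val_inj/perm_inj ->; lia.
  have := ms i j lt_ij; rewrite exc_i exc_j => /(_ erefl) lt_ss.
  have /implyP ex := forallP (forallP (forallP av i) j) k.
  have /ex/existsP[l /and3P[il lj _]] : [&& i < j, j < k, s k < s i & s i < s j].
    by apply/and4P; split=> //; lia.
  lia.
apply/forallP => i; apply/forallP => j; apply/forallP => k; apply/implyP.
case/and4P=> ij jk ki si_sj; have ik : i < k by lia.
have mik := ms _ _ ik; have mjk := ms _ _ jk.
have lt_i1 : i.+1 < n by apply: leq_trans (ltn_ord j); lia.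
pose l := Ordinal lt_i1; have := sp i l erefl.
have eq_jl : (j : nat) = i.+1 -> (s j : nat) = s l.
  by move=> eq_j; congr (s _ : nat); apply: val_inj.
have := ms l k; have -> : l = i.+1 :> nat by [].
move=> mlk nlk; apply/existsP; exists l; apply/and3P; split; rewrite /=; lia.
Qed.

End Classes.

(** * Sparsity of words, and the three identities *)

Lemma sparseP p w : reflect
  (~~ (p && (nth (false, false) w 0).1) /\
   forall m, ~~ ((nth (false, false) w m).1 && (nth (false, false) w m.+1).1))
  (sparse p w).
Proof.
elim: w p => [|[o c] w IHw] p /=.
  (* The default letter (0, 0) does not open, so indices beyond the end impose nothing. *)
  by left; rewrite andbF; split=> // m; rewrite nth_nil.
apply: (iffP andP) => [[po /IHw[w0 wm]]|[po wm]].
  by split=> // -[|m]; [exact: w0 | exact: wm].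
by split=> //; apply/IHw; split=> [|m]; [apply: (wm 0%N) | apply: (wm m.+1)].
Qed.

Lemma sparse_perm_word n (s : 'S_n) : reflect (sparse_exc s) (sparse false (perm_word s)).
Proof.
apply: (iffP (sparseP _ _)) => [[_ sp] i j eq_j|sp].
  by have sp_i := sp i; rewrite -eq_j -!tnth_nth !tnth_mktuple in sp_i.
split=> // m; case: (ltnP m.+1 n) => lt_m; last first.
  by rewrite (@nth_default _ _ _ m.+1) ?size_tuple // andbF.
have := sp (Ordinal (ltnW lt_m)) (Ordinal lt_m) erefl.
by rewrite -(tnth_nth _ _ (Ordinal (ltnW lt_m))) -(tnth_nth _ _ (Ordinal lt_m)) !tnth_mktuple.
Qed.

Lemma motzkin_perm_word n (s : 'S_n) : is_involution s -> motzkin_word (perm_word s).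
Proof.
by move=> Is; apply/motzkin_wordP => i; rewrite tnth_mktuple /= involution_inv //; lia.
Qed.

Theorem theorem1p1 (n : nat) :
  [/\ M n = \sum_(s in I_4321 n) 'X^(cr s + nes s),
      \sum_(s in I_4321 n) 'X^(cr s + nes s) =
        \sum_(s in I_3412 n) 'X^(nes s) :> {poly int} &
      Mt n = \sum_(s in S_321_3b142 n) 'X^(cr s)].
Proof.
have gf4321 : \sum_(s in I_4321 n) 'X^(cr s + nes s) = M n.
  rewrite -motzkin_gf; apply: perm_class_gf => [s t|s|w bw Mw]; rewrite ?inE.
  - by case/andP=> Is /avoids_p4321P - /(_ Is) ns /andP[It /avoids_p4321P - /(_ It) nt];
    apply: nonnesting_inj.
  - by case/andP=> Is _; apply: motzkin_perm_word.
  - have [s [Is ns ws]] := exists_nonnesting bw Mw.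
    by exists s => //; rewrite inE Is; apply/avoids_p4321P.
have gf3412 : \sum_(s in I_3412 n) 'X^(nes s) = M n.
  (* [cr] vanishes on this class, so [nes] is [cr + nes]. *)
  rewrite -motzkin_gf -(@perm_class_gf n (I_3412 n)) => [|s t|s|w bw Mw]; rewrite ?inE.
  - apply: eq_bigr => s; rewrite inE => /andP[Is /avoids_p3412P - /(_ Is) ncs].
    by rewrite noncrossing_cr.
  - by case/andP=> Is /avoids_p3412P - /(_ Is) ns /andP[It /avoids_p3412P - /(_ It) nt];
    apply: noncrossing_inj.
  - by case/andP=> Is _; apply: motzkin_perm_word.
  - have [s [Is ns ws]] := exists_noncrossing bw Mw.
    by exists s => //; rewrite inE Is; apply/avoids_p3412P.
split; rewrite ?gf4321 ?gf3412 //.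
(* Here [nes] vanishes instead. *)
rewrite -sparse_gf -(@perm_class_gf n (S_321_3b142 n)) => [|s t|s|w bw Sw]; rewrite ?inE.
- apply: eq_bigr => s; rewrite inE => /andP[/avoids_p321_excP ms _].
  by rewrite exc_monotone_nes ?addn0.
- by case/andP=> /avoids_p321_excP ms _ /andP[/avoids_p321_excP mt _]; apply: exc_monotone_inj.
- by case/andP=> /avoids_p321_excP ms /avoids_3b142P - /(_ ms)/sparse_perm_word.
- have [s ms ws] := exists_exc_monotone bw.
  exists s => //; rewrite inE; apply/andP; split; first exact/avoids_p321_excP.
  by apply/(avoids_3b142P ms)/sparse_perm_word; rewrite ws.
Qed.
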